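(* Let $n\ge 1$ and let $\gamma=[1,2,\dots,n]\in C_n$. Let $NCP$ denote Reiner's non-crossing partition lattice for the $C_n$ group. The mapping $$\{\alpha\in C_n : \alpha\le\gamma\}\longrightarrow NCP$$ which takes $\alpha$ to the noncrossing partition defined by its cycle structure is a (well-defined) bijective poset map. In particular, $\{\alpha\in C_n:\alpha\le\gamma\}$ (with the partial order $\le$) is a lattice.
   Context: $C_n$ is the group of all $\alpha\in O(n)$ with $\alpha([-1,1]^n)=[-1,1]^n$. It acts on $\{\pm e_1,\dots,\pm e_n\}$ and is thereby identified with the group of permutations $\alpha$ of $A=\{1,\dots,n,-1,\dots,-n\}$ satisfying $\alpha(-i)=-\alpha(i)$; products of permutations are composed from right to left. The balanced cycle $[i_1,\dots,i_k]$ denotes the $2k$-cycle $(i_1,\dots,i_k,-i_1,\dots,-i_k)$. The set $\mathcal R$ of reflections in $C_n$ consists of all elements of $C_n$ that are orthogonal reflections in hyperplanes (the hyperplanes $x_i=0$ and $x_i=\pm x_j$, $i\ne j$). The reflection length $l(w)$ is the least $k$ such that $w$ is a product of $k$ elements of $\mathcal R$, and $u\le w$ means $l(w)=l(u)+l(u^{-1}w)$; this is a partial order on $C_n$. Reiner's lattice $NCP$: its elements are the partitions of $A$ which are invariant under $i\mapsto -i$ (the negative of a block is a block) and which are noncrossing with respect to the cyclic order $1,2,\dots,n,-1,-2,\dots,-n$ (there are no four elements $a,b,c,d$ occurring in this cyclic order with $a,c$ in one block and $b,d$ in a different block). It is ordered by refinement ($\pi\le\pi'$ if every block of $\pi$ is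 contained in a block of $\pi'$). The partition defined by the cycle structure of $\alpha$ is the partition of $A$ into the orbits of $\alpha$ (fixed points giving singleton blocks). A poset map is an order-preserving map. *)

(* Defs.v *)
From mathcomp Require Import all_boot all_order all_fingroup all_algebra.
From mathcomp Require Import boolp classical_sets functions reals.

Set Implicit Arguments.
Unset Strict Implicit.
Unset Printing Implicit Defensive.

Import Order.TTheory GRing.Theory Num.Theory.

Local Open Scope ring_scope.

(* The set A = {1, .., n, -1, .., -n}: (false, i) encodes i + 1 and           *)
(* (true, i) encodes - (i + 1).                                               *)
Definition signed (n : nat) : finType := (bool * 'I_n)%type.

Definition sopp n (a : signed n) : signed n := (~~ a.1, a.2).

Lemma soppK n : involutive (@sopp n).
Proof. by case=> b i; rewrite /sopp /= negbK. Qed.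

Definition Cn n : {set {perm signed n}} :=
  [set w : {perm signed n} | [forall a, w (sopp a) == sopp (w a)]].

(* The vector e_i or - e_i of R^n attached to an element of A.                *)
Definition svec (R : realType) n (a : signed n) : 'cV[R]_n :=
  (-1) ^+ a.1 *: delta_mx a.2 0.

(* The matrix M permutes {e_1, .., e_n, - e_1, .., - e_n} according to w;     *)
(* this is the identification of C_n with a group of isometries of R^n, see   *)
(* cube_groupP below.                                                         *)
Definition acts_as (R : realType) n (M : 'M[R]_n) (w : {perm signed n}) : Prop :=
  forall a : signed n, M *m svec R a = svec R (w a).

Definition cube (R : realType) n : set 'cV[R]_n :=
  [set x | forall i, -1 <= x i 0 <= 1]%classic.

Definition cube_group (R : realType) n : set 'M[R]_n :=
  [set M | M^T *m M = 1%:M /\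
           [set M *m x | x in @cube R n] = @cube R n]%classic.

Lemma svec_sopp (R : realType) n (a : signed n) :
  svec R (sopp a) = - svec R a.
Proof. by rewrite /svec /= signrN scaleNr. Qed.

Lemma svec_inj (R : realType) n : injective (@svec R n).
Proof.
move=> [b i] [c j] /matrixP/(_ i 0); rewrite !mxE /= !eqxx andbT mulr1.
have [<-|_] := eqVneq i j; last by move/eqP; rewrite mulr0 signr_eq0.
by rewrite mulr1 => /signr_inj ->.
Qed.

Lemma svec_dot (R : realType) n (a : signed n) (x : 'cV[R]_n) :
  ((svec R a)^T *m x) 0 0 = (-1) ^+ a.1 * x a.2 0.
Proof.
rewrite /svec linearZ /= trmx_delta -scalemxAl -rowE mxE.
by rewrite mxE.
Qed.

Lemma acts_as_orth (R : realType) n (M : 'M[R]_n) (w : {perm signed n}) :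
  w \in Cn n -> acts_as M w -> M^T *m M = 1%:M.
Proof.
rewrite inE => /forallP wN Mw; apply/matrixP=> i j.
have colE k : M *m svec R (false, k) = col k M by rewrite /svec scale1r colE.
have -> : (M^T *m M) i j = ((col i M)^T *m col j M) 0 0.
  by rewrite !mxE; apply: eq_bigr => k _; rewrite !mxE.
rewrite -!colE !Mw svec_dot !mxE eqxx andbT.
have [->|ij] := eqVneq i j; first by rewrite eqxx mulr1 -expr2 sqrr_sign.
case: eqVneq => [e|_]; last by rewrite !mulr0.
have [/perm_inj[/eqP]|] := eqVneq (w (false, i)) (w (false, j)).
  by rewrite (negPf ij).
have [/perm_inj[]//|] := eqVneq (w (false, i)) (w (sopp (false, j))).
rewrite (eqP (wN _)) /sopp.
case: (w _) (w _) e => b k [c l] /= ->.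
by rewrite !xpair_eqE eqxx !andbT; case: b; case: c.
Qed.

Lemma acts_as_cube (R : realType) n (M : 'M[R]_n) (w : {perm signed n}) x :
  w \in Cn n -> acts_as M w -> cube x -> cube (M *m x).
Proof.
move=> wC Mw xC i; have MM := acts_as_orth wC Mw.
have MT : M^T *m svec R (false, i) = svec R (w^-1%g (false, i)).
  by rewrite -[in LHS](permKV w (false, i)) -Mw mulmxA MM mul1mx.
have := svec_dot (false, i) (M *m x); rewrite mul1r /= => <-.
rewrite mulmxA -[_ *m M]trmxK trmx_mul trmxK MT svec_dot.
case/andP: (xC (w^-1%g (false, i)).2) => x1 x2.
by case: (_.1); rewrite ?expr1 ?mulN1r ?mul1r ?x1 ?x2 // lerN2 x2 lerNl x1.
Qed.

Lemma acts_as_tr (R : realType) n (M : 'M[R]_n) (w : {perm signed n}) :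
  w \in Cn n -> acts_as M w -> w^-1%g \in Cn n /\ acts_as M^T w^-1%g.
Proof.
move=> wC Mw; have MM := acts_as_orth wC Mw; split.
  move: wC; rewrite !inE => /forallP wN; apply/forallP=> a.
  by rewrite -(inj_eq (@perm_inj _ w)) permKV (eqP (wN _)) permKV.
by move=> a; rewrite -[in LHS](permKV w a) -Mw mulmxA MM mul1mx.
Qed.

Lemma cube_group_entry (R : realType) n (M : 'M[R]_n) i j :
  cube_group M -> M i j ^+ 2 = `|M i j|.
Proof.
case=> MM MC; have MM' := mulmx1C MM.
have rowS : \sum_k M i k ^+ 2 = 1.
  have := congr1 (fun A : 'M_n => A i i) MM'; rewrite !mxE eqxx mulr1n => <-.
  by apply: eq_bigr => k _; rewrite mxE expr2.
have rowA : \sum_k `|M i k| <= 1.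
  pose x : 'cV[R]_n := \col_k (-1) ^+ (M i k < 0)%R.
  have xC : cube x.
    by move=> k; rewrite mxE; case: (_ < _); rewrite ?expr1 ?expr0 lexx ?andbT ?ge0_cp.
  have : cube (M *m x) by rewrite -MC; exists x.
  move/(_ i)/andP=> [_]; rewrite mxE; apply: le_trans.
  by apply: ler_sum => k _; rewrite mxE mulrC -normrEsign.
have le1 k : `|M i k| <= 1.
  by apply: le_trans rowA; rewrite (bigD1 k) //= lerDl sumr_ge0.
have ge k : 0 <= `|M i k| - M i k ^+ 2.
  by rewrite subr_ge0 -real_normK ?num_real // expr2 ler_piMr.
have /eqP : \sum_k (`|M i k| - M i k ^+ 2) = 0.
  apply/eqP; rewrite eq_le sumr_ge0 // andbT sumrB rowS subr_le0 //.
rewrite psumr_eq0 // => /allP/(_ j); rewrite mem_index_enum /= subr_eq0.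
by move=> /(_ isT)/eqP.
Qed.

Lemma cube_group_svec (R : realType) n (M : 'M[R]_n) (a : signed n) :
  cube_group M -> exists b : signed n, M *m svec R a = svec R b.
Proof.
move=> MC; case: a => c j.
have Mj k : M k j ^+ 2 = `|M k j| by apply: cube_group_entry.
have colS : \sum_k M k j ^+ 2 = 1.
  case: MC => /(congr1 (fun A : 'M_n => A j j)) + _; rewrite !mxE eqxx mulr1n => <-.
  by apply: eq_bigr => k _; rewrite mxE expr2.
have [i Mi|M0] := pickP (fun k => M k j != 0); last first.
  move/eqP: colS; rewrite big1 ?(eq_sym 0) ?oner_eq0 // => k _.
  by have /negbFE/eqP -> := M0 k; rewrite expr0n.
have Mi1 : `|M i j| = 1.
  apply: (mulfI (x := `|M i j|)); rewrite ?normr_eq0 // mulr1 -expr2.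
  by rewrite real_normK ?num_real.
have M0 k : k != i -> M k j = 0.
  move=> ki; move/eqP: colS; rewrite (bigD1 i) //= Mj Mi1 -subr_eq0 addrAC subrr add0r.
  rewrite psumr_eq0 => [/allP/(_ k)|l _]; last exact: sqr_ge0.
  by rewrite mem_index_enum ki sqrf_eq0 /= => /(_ isT)/eqP.
exists (c (+) (M i j < 0), i).
rewrite /svec /= -scalemxAr signr_addb -scalerA -colE; congr (_ *: _).
apply/matrixP=> k l; rewrite !mxE ord1 eqxx andbT.
have [->|ki] := eqVneq k i; last by rewrite (M0 k) ?mulr0.
by rewrite mulr1 [LHS]numEsign Mi1 mulr1.
Qed.

Lemma cube_groupP (R : realType) n (M : 'M[R]_n) :
  cube_group M <-> exists2 w, w \in Cn n & acts_as M w.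
Proof.
split=> [MC|[w wC Mw]]; last first.
  have [wC' Mw'] := acts_as_tr wC Mw.
  split; first exact: acts_as_orth wC Mw.
  apply/seteqP; split=> [_ [x xC <-]|x xC]; first exact: acts_as_cube wC Mw xC.
  exists (M^T *m x); first exact: acts_as_cube wC' Mw' xC.
  by rewrite mulmxA (mulmx1C (acts_as_orth wC Mw)) mul1mx.
have [f fP] := choice (fun a => cube_group_svec a MC).
have f_inj : injective f.
  move=> a b fab; apply: (@svec_inj R); case: MC => MM _.
  by rewrite -[LHS]mul1mx -MM -mulmxA fP fab -fP mulmxA MM mul1mx.
exists (perm f_inj); last by move=> a; rewrite permE.
rewrite inE; apply/forallP=> a; rewrite !permE; apply/eqP/(@svec_inj R).
by rewrite svec_sopp -!fP svec_sopp mulmxN.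
Qed.


(* The orthogonal reflection in the hyperplane orthogonal to v != 0, that is, *)
(* x |-> x - 2 (<v, x> / <v, v>) v.                                           *)
Definition reflection_mx (R : realType) n (v : 'cV[R]_n) : 'M[R]_n :=
  1%:M - (2 / (v^T *m v) 0 0) *: (v *m v^T).

Definition reflections (R : realType) n : {set {perm signed n}} :=
  [set w in Cn n |
     `[< exists v : 'cV[R]_n, v != 0 /\ acts_as (reflection_mx v) w >]].

(* (reflections R n ^+ k)%g is the pointwise power, i.e. the set of all       *)
(* products of k reflections. The default value 0 is never used for w in C_n, *)
(* since C_n is generated by its reflections.                                 *)
Definition refl_length (R : realType) n (w : {perm signed n}) : nat :=
  match pselect (exists k, w \in (reflections R n ^+ k)%g) with
  | left ex_k => ex_minn ex_k
  | right _ => 0%N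
  end.

(* Permutations are composed from right to left in the definition of the      *)
(* order, whereas (s * t)%g x = t (s x): the product u^-1 w is (w * u^-1)%g.  *)
Definition refl_le (R : realType) n : rel {perm signed n} :=
  fun u w => refl_length R w == (refl_length R u + refl_length R (w * u^-1)%g)%N.

Definition balanced n (s : seq (signed n)) : seq (signed n) :=
  s ++ [seq sopp a | a <- s].

(* The cyclic order 1, 2, .., n, -1, -2, .., -n.                              *)
Definition cyc_word n : seq (signed n) :=
  balanced [seq (false, i) | i <- enum 'I_n].

Lemma cyc_word_uniq n : uniq (cyc_word n).
Proof.
have Us : uniq [seq (false, i) | i <- enum 'I_n].
  by rewrite map_inj_uniq ?enum_uniq // => i j [].
rewrite cat_uniq Us (map_inj_uniq (can_inj (@soppK n))) Us andbT /=.
by apply/hasPn=> _ /mapP[_ /mapP[i _ ->] ->]; apply/mapP=> -[].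
Qed.

Lemma next_inj (T : eqType) (s : seq T) : uniq s -> injective (next s).
Proof. by move=> Us; apply: can_inj (prev_next Us). Qed.

(* The balanced cycle [1, 2, .., n].                                          *)
Definition gamma n : {perm signed n} := perm (next_inj (cyc_word_uniq n)).

Definition below_gamma (R : realType) n : {set {perm signed n}} :=
  [set w in Cn n | refl_le R w (gamma n)].

Definition cyclically_ordered n (a b c d : signed n) : bool :=
  has (fun k => subseq [:: a; b; c; d] (rot k (cyc_word n)))
      (iota 0 (size (cyc_word n))).

Definition noncrossing n (P : {set {set signed n}}) : bool :=
  [forall B in P, forall B' in P, (B != B') ==>
    ~~ [exists a in B, exists b in B', exists c in B, exists d in B',
          cyclically_ordered a b c d]].

Definition NCP n : {set {set {set signed n}}} :=
  [set P | [&& finset.partition P [set: signed n],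
               [forall B in P, [set sopp a | a in B] \in P]
             & noncrossing P]].

Definition refines (T : finType) : rel {set {set T}} :=
  fun P Q => [forall B in P, exists B' in Q, B \subset B'].

Definition lattice_on (T : finType) (D : {set T}) (le : rel T) : Prop :=
  [/\ {in D, reflexive le}, {in D &, antisymmetric le},
      {in D & &, transitive le},
      {in D &, forall x y, exists2 z, z \in D &
         {in D, forall t, le t z = le t x && le t y}}
    & {in D &, forall x y, exists2 z, z \in D &
         {in D, forall t, le z t = le x t && le y t}}].

(* Main.v *)
Require Import Defs.
From mathcomp Require Import all_boot all_order all_fingroup all_algebra.
From mathcomp Require Import zify ring.
From mathcomp Require Import boolp classical_sets functions reals.

Set Implicit Arguments.
Unset Strict Implicit.
Unset Printing Implicit Defensive.

Import Order.TTheory GRing.Theory Num.Theory.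

Local Open Scope ring_scope.

(** Let [A_w] be the matrix [M_w - 1], where [M_w] is the signed permutation
    matrix of [w].  The reflection length of [w] is the rank of [A_w]
    ([refl_length_rank]): a reflection changes the rank by at most one, and
    when [w a <> a] the reflection exchanging [w a] and [a] lowers it.  So
    [u <= w] says that [rank A_w = rank A_u + rank (A_w - A_u)], which is the
    minus partial order on matrices.  By [minus_order] this rank equation
    amounts to inclusions of row and column spaces together with
    [A_u H A_u = A_u], for any [H] with [A_w H A_w = A_w].

    For [w = gamma] the matrix [A_gamma] is invertible and
    [A_gamma^-1 (e_b - e_a)] is the sum of the [e_x] over the half-open cyclic
    interval from [a] to [b].  Reading [A_w A_gamma^-1 A_w = A_w] on the vector
    [e_a] therefore says that [w] fixes the sum of the [e_x] over the open
    interval from [a] to [w a].  Because [e_(-x) = - e_x], such a sum could in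
    principle forget part of the interval, but the shape of cyclic intervals
    excludes it, and the condition becomes combinatorial
    ([below_gamma_arcs]): for each [a], the open interval from [a] to [w a] is
    a union of orbits of [w].  This says at once that the orbits are
    noncrossing ([porbits_NCP]) and that [w] sends each point to the next point
    of its orbit; conversely the next-point permutation of a noncrossing
    partition satisfies the condition ([NCP_perm]).

    For two elements below [gamma] the minus order reduces to the inclusion of
    row spaces, that is, to the reverse inclusion of fixed spaces.  The vectors
    fixed by [w] are those whose coordinates are constant on the orbits of [w],
    and a noncrossing partition has at most one self-opposite block, so the
    fixed spaces determine the orbits and [u <= w] is equivalent to the
    refinement of partitions ([refl_le_refines]).  Finally the common
    refinement of noncrossing partitions is noncrossing, so all greatest lower
    bounds exist; least upper bounds follow because the order is finite. *)

(** * The minus order on matrices *)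

Section MinusOrder.
Variable F : fieldType.

(** The row space of a sum lies in the sum of the row spaces; additivity of the
    ranks leaves room neither for a strict inclusion nor for an
    intersection. *)
Lemma rank_additive_sub m n (A B : 'M[F]_(m, n)) :
  \rank (A + B)%R = (\rank A + \rank B)%N ->
  (A <= (A + B)%R)%MS /\ (A :&: B)%MS = 0.
Proof.
move=> rAB; have sAB : ((A + B)%R <= A + B)%MS by apply: addmx_sub_adds.
have le1 := mxrankS sAB; have [le2 e2] := mxrank_adds_leqif A B.
have eqr : \rank (A + B)%MS = (\rank A + \rank B)%N.
  by apply/eqP; rewrite eqn_leq le2 -rAB le1.
split.
  apply: submx_trans (addsmxSl A B) _.
  by have := mxrank_leqif_sup sAB; rewrite eqr rAB => -[_ <-].
by move: e2; rewrite eqr eqxx => /esym; rewrite submx0 => /eqP.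
Qed.

(** If the ranks add up, every row of [A - A H A = A H (W - A)] lies in the row
    spaces of both [A] and [W - A], which meet trivially.  Conversely the two
    inclusions give [A H W = A = W H A], so right multiplication by [H A] is
    the identity on the rows of [A] and kills those of [W - A]. *)
Lemma minus_order m n (W A : 'M[F]_(m, n)) (H : 'M[F]_(n, m)) :
  W *m H *m W = W ->
  (\rank W == \rank A + \rank (W - A)%R)%N =
  [&& (A <= W)%MS, (A^T <= W^T)%MS & A *m H *m A == A].
Proof.
move=> WHW; apply/eqP/and3P => [rW|[/submxP[X AX] /submxP[Y AY] /eqP AHA]].
  have WE : A + (W - A) = W by rewrite addrC subrK.
  have [sA cap0] : (A <= W)%MS /\ (A :&: (W - A)%R)%MS = 0.
    by have [] := @rank_additive_sub _ _ A (W - A); rewrite WE.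
  have sAT : (A^T <= W^T)%MS.
    have [] := @rank_additive_sub _ _ A^T (W - A)^T; last first.
      by rewrite -linearD WE.
    by rewrite -linearD WE !mxrank_tr.
  split=> //; rewrite eq_sym -subr_eq0 -submx0 -cap0 sub_capmx.
  have /submxP[X AX] := sA.
  have AHW : A *m H *m W = A by rewrite AX -!mulmxA (mulmxA W) WHW.
  apply/andP; split; first by rewrite addmx_sub // eqmx_opp submxMl.
  by rewrite -{1}AHW -mulmxBr submxMl.
have AHW : A *m H *m W = A by rewrite AX -!mulmxA (mulmxA W) WHW.
have AY' : A = W *m Y^T by rewrite -[W]trmxK -trmx_mul -AY trmxK.
have WHA : W *m H *m A = A by rewrite AY' mulmxA WHW.
apply/eqP; rewrite eqn_leq; apply/andP; split.
  by rewrite -{1}[W](subrK A) addrC mxrank_add.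
rewrite -mxrank_disjoint_sum.
  apply: mxrankS; rewrite addsmx_sub AX submxMl.
  by rewrite -{1}[W]mul1mx -mulmxBl submxMl.
apply/eqP/rowV0P => v; rewrite sub_capmx => /andP[/submxP[y vy] /submxP[z vz]].
have v1 : v *m H *m A = v by rewrite vy -!mulmxA (mulmxA A) AHA.
rewrite -v1 vz -!mulmxA (mulmxA (W - A)) mulmxBl mulmxBl WHA AHA.
by rewrite subrr mulmx0.
Qed.
End MinusOrder.

(** * Matrices of signed permutations *)

Section SignedMatrix.
Variables (R : realType) (n : nat).
Implicit Types (a b x y : signed n) (u w : {perm signed n}).
Implicit Types (B : {set signed n}).
Local Notation sv := (svec R).

Lemma Cn_sopp w a : w \in Cn n -> w (sopp a) = sopp (w a).
Proof. by rewrite inE => /forallP/(_ a)/eqP. Qed.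

Lemma Cn_mul u w : u \in Cn n -> w \in Cn n -> (u * w)%g \in Cn n.
Proof.
by move=> uC wC; rewrite inE; apply/forallP=> a; rewrite !permM !Cn_sopp.
Qed.

Lemma Cn_inv w : w \in Cn n -> w^-1%g \in Cn n.
Proof.
move=> wC; rewrite inE; apply/forallP=> a; apply/eqP/(@perm_inj _ w).
by rewrite permKV Cn_sopp // permKV.
Qed.

Lemma Cn1 : 1%g \in Cn n.
Proof. by rewrite inE; apply/forallP=> a; rewrite !perm1. Qed.

Lemma svec_ext m (A B : 'M[R]_(m, n)) :
  (forall a, A *m sv a = B *m sv a) -> A = B.
Proof.
move=> AB; apply/matrixP=> i j.
have := AB (false, j); rewrite /svec !scale1r -!colE => /matrixP/(_ i 0).
by rewrite !mxE.
Qed.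

Definition smx w : 'M[R]_n := \matrix_(i, j) sv (w (false, j)) i 0.

Lemma smx_acts w : w \in Cn n -> acts_as (smx w) w.
Proof.
move=> wC; have smxF j : smx w *m sv (false, j) = sv (w (false, j)).
  by rewrite /svec scale1r -colE; apply/matrixP=> i k; rewrite !mxE ord1.
case=> [[] j]; last exact: smxF.
by rewrite (svec_sopp R (false, j)) mulmxN smxF -svec_sopp -Cn_sopp.
Qed.

Lemma acts_as_smx (M : 'M[R]_n) w : w \in Cn n -> acts_as M w -> M = smx w.
Proof. by move=> wC Mw; apply: svec_ext => a; rewrite Mw smx_acts. Qed.

Lemma smx1 : smx 1 = 1%:M.
Proof. by apply/esym/acts_as_smx=> [|a]; rewrite ?Cn1 // perm1 mul1mx. Qed.

Lemma smxM u w : u \in Cn n -> w \in Cn n -> smx (u * w)%g = smx w *m smx u.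
Proof.
move=> uC wC; apply/esym/acts_as_smx=> [|a]; first exact: Cn_mul.
by rewrite -mulmxA !smx_acts // permM.
Qed.

Lemma smx_tr w : w \in Cn n -> (smx w)^T = smx w^-1%g.
Proof.
move=> wC; have [wC' Mw'] := acts_as_tr wC (smx_acts wC).
exact: acts_as_smx Mw'.
Qed.

Lemma smx_inj : {in Cn n &, injective smx}.
Proof.
move=> u w uC wC uw; apply/permP=> a.
by apply: (@svec_inj R); rewrite -!smx_acts // uw.
Qed.

Lemma smx_mulT w : w \in Cn n -> (smx w)^T *m smx w = 1%:M.
Proof. by move=> wC; apply: acts_as_orth wC (smx_acts wC). Qed.

Definition displ w : 'M[R]_n := smx w - 1%:M.

Lemma displ_svec w a : w \in Cn n -> displ w *m sv a = sv (w a) - sv a.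
Proof. by move=> wC; rewrite mulmxBl mul1mx smx_acts. Qed.

Lemma displ_tr w : w \in Cn n -> (displ w)^T = - ((smx w)^T *m displ w).
Proof.
by move=> wC; rewrite mulmxBr smx_mulT // mulmx1 opprB linearB /= trmx1.
Qed.

Lemma displ_inj : {in Cn n &, injective displ}.
Proof. by move=> u w uC wC /addIr; apply: smx_inj. Qed.

(** Orthogonality: the image of [M_w - 1] is the orthogonal complement of its
    kernel, so row space and column space coincide. *)
Lemma displ_tr_eqmx w : w \in Cn n -> ((displ w)^T :=: displ w)%MS.
Proof.
move=> wC; have sT : ((displ w)^T <= displ w)%MS.
  by rewrite displ_tr // eqmx_opp submxMl.
apply/eqmxP; rewrite sT; have [_ <-] := mxrank_leqif_sup sT.
by rewrite mxrank_tr eqxx.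
Qed.

Lemma rank_displ_quot u w : u \in Cn n -> w \in Cn n ->
  \rank (displ (w * u^-1)%g) = \rank (displ w - displ u).
Proof.
move=> uC wC; have -> : displ (w * u^-1)%g = (smx u)^T *m (displ w - displ u).
  rewrite /displ smxM ?Cn_inv // opprB addrA subrK mulmxBr smx_mulT //.
  by rewrite smx_tr.
rewrite -mxrank_tr trmx_mul trmxK mxrankMfree ?mxrank_tr //.
by rewrite row_free_unit; have [] := mulmx1_unit (smx_mulT uC).
Qed.

(** The coordinate of [z] along [svec a]; it is an odd function of [a]. *)
Definition scoord (z : 'cV[R]_n) a := ((sv a)^T *m z) 0 0.

Lemma scoord_inj (z1 z2 : 'cV[R]_n) : scoord z1 =1 scoord z2 -> z1 = z2.
Proof.
move=> zz; apply/matrixP=> i j; rewrite ord1.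
by have := zz (false, i); rewrite /scoord !svec_dot !mul1r.
Qed.

Lemma scoord_smx w z a : w \in Cn n -> scoord (smx w *m z) (w a) = scoord z a.
Proof.
move=> wC; rewrite /scoord -smx_acts // trmx_mul.
by rewrite mulmxA -(mulmxA (sv a)^T) smx_mulT // mulmx1.
Qed.

Lemma displ_ker w z : w \in Cn n ->
  displ w *m z = 0 <-> forall a, scoord z (w a) = scoord z a.
Proof.
move=> wC; rewrite mulmxBl mul1mx; split=> [/subr0_eq wz a|wz].
  by rewrite -{1}wz scoord_smx.
apply/eqP; rewrite subr_eq0; apply/eqP/scoord_inj => a.
by rewrite -[a](permKV w) scoord_smx // wz.
Qed.

Lemma scoord_svec a b : scoord (sv a) b = (b == a)%:R - (sopp b == a)%:R.
Proof.
rewrite /scoord svec_dot !mxE eqxx andbT.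
case: a b => [[] i] [[] j]; rewrite /sopp /= !xpair_eqE /=; case: (j == i).
all: rewrite /= ?(expr0, expr1, mulr0, mulr1, mulN1r, opprK).
all: by rewrite ?(mul1r, oppr0, subr0, sub0r, addr0, subrr).
Qed.

Definition vsum B : 'cV[R]_n := \sum_(x in B) sv x.

Lemma scoord_vsum B a : scoord (vsum B) a = (a \in B)%:R - (sopp a \in B)%:R.
Proof.
rewrite /scoord /vsum mulmx_sumr summxE.
have cE x : ((sv a)^T *m sv x) 0 0 = (a == x)%:R - (sopp a == x)%:R.
  exact: scoord_svec.
rewrite (eq_bigr _ (fun x _ => cE x)) sumrB.
have S c : \sum_(x in B) (c == x)%:R = (c \in B)%:R :> R.
  have [cB|cB] := boolP (c \in B).
    rewrite (bigD1 c) //= eqxx big1 ?addr0 // => x /andP[_ /negPf].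
    by rewrite eq_sym => ->.
  by rewrite big1 // => x xB; case: eqP cB xB => // -> /negPf ->.
by rewrite !S.
Qed.

(** Sets that can be recovered from their signed indicator, the function
    [x |-> (x \in B) - (sopp x \in B)] of [scoord_vsum]: either [x \in B]
    exactly where it is 1, or [x \notin B] exactly where it is -1. *)
Definition one_sided B : Prop :=
  (forall y, y \in B -> sopp y \notin B) \/
  (forall y, y \notin B -> sopp y \in B).

Lemma vsum_stable w B : w \in Cn n -> one_sided B ->
  displ w *m vsum B = 0 <-> forall y, (w y \in B) = (y \in B).
Proof.
move=> wC Bs; split=> [/(displ_ker _ wC) wB y|wB]; last first.
  by apply/displ_ker=> // a; rewrite !scoord_vsum -Cn_sopp // !wB.
move: (wB y); rewrite !scoord_vsum -Cn_sopp //.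
case: Bs => sB; move: (sB y) (sB (w y)); rewrite -Cn_sopp //.
all: do 4![case: (_ \in B)] => //= p q.
all: try by [move: (p isT) | move: (q isT)].
all: move/eqP; rewrite ?(subr0, sub0r, subrr) ?(eq_sym 0).
all: rewrite ?oppr_eq0 ?oner_eq0 //.
all: by rewrite -subr_eq0 ?opprK -?opprD ?oppr_eq0 (pnatr_eq0 R 2).
Qed.
End SignedMatrix.

(** * Reflection length is the rank of the displacement *)

Section ReflectionLength.
Variables (R : realType) (n : nat).
Implicit Types (a b x y : signed n) (u w r : {perm signed n}).
Local Notation sv := (svec R).

Lemma reflection_mulmx (v z : 'cV[R]_n) :
  reflection_mx v *m z = z - (2 / (v^T *m v) 0 0 * (v^T *m z) 0 0) *: v.
Proof.
rewrite mulmxBl mul1mx -scalemxAl -mulmxA [v^T *m z]mx11_scalar mul_mx_scalar.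
by rewrite scalerA !mxE.
Qed.

Lemma sqnorm_gt0 (v : 'cV[R]_n) : v != 0 -> 0 < (v^T *m v) 0 0.
Proof.
move=> v0; rewrite lt_def !mxE sumr_ge0 => [|i _]; last first.
  by rewrite mxE -expr2 sqr_ge0.
rewrite andbT psumr_eq0 => [|i _]; last by rewrite mxE -expr2 sqr_ge0.
apply: contra v0 => /allP v0; apply/eqP/matrixP=> i j; rewrite ord1 [RHS]mxE.
have := v0 i; rewrite mem_index_enum /= => /(_ isT).
by rewrite mxE -expr2 sqrf_eq0 => /eqP.
Qed.

Lemma reflection_mx_invol (v z : 'cV[R]_n) : v != 0 ->
  reflection_mx v *m (reflection_mx v *m z) = z.
Proof.
move=> /sqnorm_gt0/lt0r_neq0 q0.
rewrite [in X in _ *m X]reflection_mulmx mulmxBr -scalemxAr !reflection_mulmx.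
rewrite divfK // scalerBr scalerA; set k := 2 / _ * _.
by rewrite mulr_natr [k *+ 2]mulr2n scalerDl opprB !addrA addrK subrK.
Qed.

Lemma rank_reflection (v : 'cV[R]_n) :
  (\rank (reflection_mx v - 1%:M)%R <= 1)%N.
Proof.
rewrite /reflection_mx addrC addrA addNr add0r -scaleNr scalemxAl.
exact: mulmx_max_rank.
Qed.

(** The reflection along [e_b - e_a] exchanges [a] with [b] and [-a] with [-b].
    The case [b = -a], where it is the sign change of one coordinate, is not
    separated: the number [t] below records it, and cancels out. *)
Lemma svec_swap a b : a != b -> let v := sv b - sv a in
  exists2 f : signed n -> signed n, f b = a &
    forall x, reflection_mx v *m sv x = sv (f x).
Proof.
move=> ab v.
have ip x y : ((sv x)^T *m sv y) 0 0 = (x == y)%:R - (sopp x == y)%:R :> R.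
  exact: scoord_svec.
have soppN (c : signed n) : (sopp c == c) = false.
  by case: c => [[] i]; rewrite xpair_eqE.
have soppJ (c d : signed n) : (sopp c == d) = (sopp d == c).
  by apply/eqP/eqP => <-; rewrite soppK.
have ipv x : (v^T *m sv x) 0 0 =
    (x == b)%:R - (sopp b == x)%:R - ((x == a)%:R - (sopp a == x)%:R) :> R.
  rewrite /v linearB /= mulmxBl mxE [X in _ + X]mxE !ip.
  by rewrite (eq_sym a) (eq_sym b).
pose t : R := (sopp a == b)%:R.
have t1 : 1 + t != 0 by rewrite -(natrD _ 1) pnatr_eq0.
have qE : (v^T *m v) 0 0 = 2 * (1 + t).
  rewrite {2}/v mulmxBr mxE [X in _ + X]mxE !ipv !eqxx !soppN (negPf ab).
  rewrite (eq_sym b) (negPf ab) (soppJ b) -/t.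
  rewrite !(subr0, sub0r) /=; ring.
have Ma : reflection_mx v *m sv a = sv b.
  rewrite reflection_mulmx qE ipv eqxx soppN (negPf ab) (soppJ b) -/t.
  rewrite [_ * _](_ : _ = -1); first by rewrite scaleN1r opprK addrC subrK.
  by rewrite !(subr0, sub0r) /=; field; rewrite t1.
have Mb : reflection_mx v *m sv b = sv a.
  rewrite -Ma reflection_mx_invol // subr_eq0 (inj_eq (@svec_inj R n)).
  by rewrite eq_sym.
exists (fun x => if x == a then b else if x == b then a else
  if x == sopp a then sopp b else if x == sopp b then sopp a else x).
  by rewrite eqxx eq_sym (negPf ab).
move=> x; have [->//|xa] := eqVneq x a; have [->//|xb] := eqVneq x b.
have [->|xa'] := eqVneq x (sopp a); first by rewrite !svec_sopp mulmxN Ma.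
have [->|xb'] := eqVneq x (sopp b); first by rewrite !svec_sopp mulmxN Mb.
rewrite reflection_mulmx ipv (negPf xa) (negPf xb) !(eq_sym (sopp _)).
by rewrite (negPf xa') (negPf xb') !subrr mulr0 scale0r subr0.
Qed.

Lemma exists_reflection a b : a != b ->
  exists2 r, r \in reflections R n &
    r b = a /\ smx R r = reflection_mx (sv b - sv a).
Proof.
move=> ab; have v0 : sv b - sv a != 0.
  by rewrite subr_eq0 (inj_eq (@svec_inj R n)) eq_sym.
have [f fb Mf] := svec_swap ab.
have f_inj : injective f.
  move=> x y fxy; apply: (@svec_inj R); have := Mf x; rewrite fxy -Mf.
  move/(congr1 (mulmx (reflection_mx (sv b - sv a)))).
  by rewrite !reflection_mx_invol.
pose r := perm f_inj.
have Mr : acts_as (reflection_mx (sv b - sv a)) r by move=> x; rewrite permE.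
have rC : r \in Cn n.
  rewrite inE; apply/forallP=> x; apply/eqP/(@svec_inj R).
  by rewrite svec_sopp -!Mr svec_sopp mulmxN.
exists r; last by rewrite permE -(acts_as_smx rC Mr).
by rewrite inE rC; apply/asboolP; exists (sv b - sv a).
Qed.

Lemma rank_prod_reflections k w :
  w \in (reflections R n ^+ k)%g -> w \in Cn n /\ (\rank (displ R w) <= k)%N.
Proof.
elim: k w => [|k IH] w.
  by rewrite expg0 => /set1P ->; rewrite Cn1 /displ smx1 subrr mxrank0.
rewrite expgS => /mulsgP[r s]; rewrite inE => /andP[rC /asboolP[v [_ Mr]]].
move=> /IH[sC rs] ->; split; first exact: Cn_mul.
have -> : displ R (r * s)%g = smx R s *m (reflection_mx v - 1%:M) + displ R s.
  by rewrite /displ smxM // [X in _ = X + _]mulmxBr mulmx1 (acts_as_smx rC Mr)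
    addrA subrK.
apply: leq_trans (mxrank_add _ _) _; rewrite -add1n leq_add //.
exact: leq_trans (mxrankM_maxr _ _) (rank_reflection v).
Qed.

(** The vector [e_(w a) - e_a] lies in the image of [M_w - 1], hence is
    orthogonal to the vectors fixed by [w]: composing with [r] keeps all of
    them fixed and also fixes [e_a], which [w] moves. *)
Lemma rank_displ_lt w a r :
    w \in Cn n -> r \in Cn n -> w a != a -> r (w a) = a ->
    smx R r = reflection_mx (sv (w a) - sv a) ->
  (\rank (displ R (w * r)%g) < \rank (displ R w))%N.
Proof.
move=> wC rC wa ra rE; have wrC := Cn_mul wC rC.
rewrite -[X in (X < _)%N]mxrank_tr -[X in (_ < X)%N]mxrank_tr.
have ltK : (kermx (displ R w)^T < kermx (displ R (w * r)%g)^T)%MS.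
  rewrite ltmxE; apply/andP; split.
    apply/row_subP => i; apply/sub_kermxP.
    have /sub_kermxP := row_sub i (kermx (displ R w)^T).
    move: (row i _) => z zw; have {}zw : displ R w *m z^T = 0.
      by rewrite -[displ _ _]trmxK -trmx_mul zw trmx0.
    suff wrz : displ R (w * r)%g *m z^T = 0.
      by rewrite -[z]trmxK -trmx_mul wrz trmx0.
    have wz : smx R w *m z^T = z^T.
      by apply/subr0_eq; rewrite -[X in _ - X]mul1mx -mulmxBl.
    rewrite /displ smxM // mulmxBl mul1mx -mulmxA wz rE reflection_mulmx.
    have -> : ((sv (w a) - sv a)^T *m z^T) 0 0 = 0.
      have /(displ_ker _ wC)/(_ a) := zw; rewrite /scoord linearB /= mulmxBl.
      by move=> e; rewrite mxE [X in _ + X]mxE e subrr.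
    by rewrite mulr0 scale0r subr0 subrr.
  apply/negP => /(submx_trans _)-/(_ _ (sv a)^T); rewrite !sub_kermx -!trmx_mul.
  rewrite !displ_svec // permM ra subrr trmx0 eqxx => /(_ isT).
  by rewrite trmx_eq0 subr_eq0 (inj_eq (@svec_inj R n)) (negPf wa).
have := rank_ltmx ltK; rewrite !mxrank_ker.
have := rank_leq_row (displ R (w * r)%g)^T; have := rank_leq_row (displ R w)^T.
by move=> l1 l2; rewrite ltn_sub2lE.
Qed.

Lemma prod_reflections_rank w : w \in Cn n ->
  exists2 k, (k <= \rank (displ R w))%N & w \in (reflections R n ^+ k)%g.
Proof.
have [m] := ubnP (\rank (displ R w)); elim: m w => // m IH w wm wC.
have [/eqP w1|w1] := boolP [forall a, w a == a].
  exists 0%N => //; rewrite expg0; apply/set1P/permP => a; rewrite perm1.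
  by move/eqP/forallP/(_ a)/eqP: w1.
move: w1; rewrite negb_forall => /existsP[a wa].
have aw : a != w a by rewrite eq_sym.
have [r rR [ra rE]] := exists_reflection aw.
have rC : r \in Cn n by move: rR; rewrite inE => /andP[].
have lt := rank_displ_lt wC rC wa ra rE.
have [||k kle wk] := IH (w * r)%g; first exact: leq_trans lt _.
  exact: Cn_mul.
exists k.+1; first exact: leq_ltn_trans lt.
have rr : (r * r)%g = 1%g.
  apply: (@smx_inj R n); rewrite ?Cn_mul ?Cn1 // smxM // smx1 rE.
  apply: svec_ext => x; rewrite -mulmxA reflection_mx_invol ?mul1mx //.
  by rewrite subr_eq0 (inj_eq (@svec_inj R n)).
by rewrite expgSr -[w]mulg1 -rr mulgA mem_mulg.
Qed.

Lemma refl_length_rank w : w \in Cn n -> refl_length R w = \rank (displ R w).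
Proof.
move=> wC; have [k kle wk] := prod_reflections_rank wC.
rewrite /refl_length; case: pselect => [ex|[]]; last by exists k.
case: ex_minnP => m wm m_min; have [_ rm] := rank_prod_reflections wm.
by apply/eqP; rewrite eqn_leq rm andbT (leq_trans _ kle) ?m_min.
Qed.

Lemma refl_leE u w : u \in Cn n -> w \in Cn n ->
  refl_le R u w =
  (\rank (displ R w) == \rank (displ R u) + \rank (displ R w - displ R u)%R)%N.
Proof.
move=> uC wC; rewrite /refl_le !refl_length_rank ?Cn_mul ?Cn_inv //.
by rewrite rank_displ_quot.
Qed.
End ReflectionLength.

(** * The cyclic order and noncrossing partitions *)

Lemma subseq_iota (s : seq nat) m k :
  sorted ltn s -> all (fun i => m <= i < m + k)%N s -> subseq s (iota m k).
Proof.
move=> s_lt /allP s_m; apply/subseq_uniqP; rewrite ?iota_uniq //.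
apply: (irr_sorted_eq ltn_trans ltnn) => //.
  by apply: (sorted_filter ltn_trans); rewrite iota_ltn_sorted.
move=> i; by rewrite mem_filter mem_iota /=; have [/s_m ->|] := boolP (i \in s).
Qed.

Section CyclicOrder.
Variable n : nat.
Implicit Types (a b c d x y : signed n) (i j k : nat).
Local Notation g := (gamma n).

Lemma mem_cyc_word a : a \in cyc_word n.
Proof.
rewrite mem_cat; case: a => [[] i]; apply/orP; [right|left].
  by apply/mapP; exists (false, i) => //; rewrite map_f ?mem_enum.
by rewrite map_f ?mem_enum.
Qed.

Lemma size_cyc_word : size (cyc_word n) = (n + n)%N.
Proof. by rewrite size_cat !(size_enum_ord, size_map). Qed.

Lemma fcycle_cyc_word : fcycle g (cyc_word n).
Proof.
rewrite -(eq_cycle (e := frel (next (cyc_word n)))).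
  exact: cycle_next (cyc_word_uniq n).
by move=> a b /=; rewrite permE.
Qed.

Lemma fconnect_gamma a b : fconnect g a b.
Proof. by rewrite (fconnect_cycle fcycle_cyc_word) ?mem_cyc_word. Qed.

Lemma order_gamma a : fingraph.order g a = (n + n)%N.
Proof.
rewrite (order_cycle fcycle_cyc_word) ?size_cyc_word ?mem_cyc_word //.
exact: cyc_word_uniq.
Qed.

(** The number of steps from [a] to [b] along the cyclic order. *)
Definition dist a b := findex g a b.

Lemma dist_lt a b : (dist a b < n + n)%N.
Proof. by rewrite -(order_gamma a) findex_max ?fconnect_gamma. Qed.

Lemma iter_dist a b : iter (dist a b) g a = b.
Proof. by rewrite iter_findex ?fconnect_gamma. Qed.

Lemma dist_iter a i : (i < n + n)%N -> dist a (iter i g a) = i.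
Proof. by move=> i_lt; rewrite /dist findex_iter ?order_gamma. Qed.

Lemma dist_eq0 a b : (dist a b == 0)%N = (a == b).
Proof. exact: findex_eq0. Qed.

Lemma dist_id a : dist a a = 0%N.
Proof. exact: findex0. Qed.

Lemma dist_sub a x y :
  (dist a x <= dist a y)%N -> dist x y = (dist a y - dist a x)%N.
Proof.
move=> xy; rewrite -{1}(iter_dist a y) -{1}(subnK xy) iterD iter_dist.
rewrite dist_iter //.
exact: leq_ltn_trans (leq_subr _ _) (dist_lt a y).
Qed.

Lemma iter_gamma2n a : iter (n + n) g a = a.
Proof. by rewrite -(order_gamma a) iter_order //; apply: perm_inj. Qed.

Lemma nth_cyc_word x0 i : (i < n + n)%N ->
  nth x0 (cyc_word n) i = iter i g (nth x0 (cyc_word n) 0).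
Proof.
rewrite -size_cyc_word; have := fcycle_cyc_word; case: (cyc_word n) => //= x s.
rewrite rcons_path => /andP[/fpathE -> _].
rewrite size_traject -trajectS => i_lt.
by rewrite (set_nth_default x) ?size_traject ?nth_traject.
Qed.

Lemma iter_gamma_n a : iter n g a = sopp a.
Proof.
have [i i_lt ai] := nthP a (mem_cyc_word a).
rewrite size_cyc_word in i_lt.
have nN j : (j < n)%N ->
    nth a (cyc_word n) (n + j) = sopp (nth a (cyc_word n) j).
  move=> jn; rewrite /cyc_word /balanced !nth_cat !(size_enum_ord, size_map) jn.
  by rewrite ltnNge leq_addr /= addKn (nth_map a) ?(size_enum_ord, size_map).
have [i_n|i_n] := ltnP i n.
  have ni_lt : (n + i < n + n)%N by rewrite ltn_add2l.
  by rewrite -{1}ai nth_cyc_word // -iterD -(nth_cyc_word _ ni_lt) nN // ai.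
have [j iE] : {j | i = (n + j)%N} by exists (i - n)%N; rewrite subnKC.
have jn : (j < n)%N by rewrite iE ltn_add2l in i_lt.
have a_nj : a = sopp (nth a (cyc_word n) j) by rewrite -nN // -iE.
rewrite {2}a_nj soppK -{1}ai (nth_cyc_word _ i_lt) -iterD iE addnA addnC iterD.
by rewrite iter_gamma2n -nth_cyc_word // ltn_addr.
Qed.

Lemma gamma_Cn : g \in Cn n.
Proof.
rewrite inE; apply/forallP=> a; apply/eqP.
by rewrite -!iter_gamma_n -iterS iterSr.
Qed.

Lemma iter_gamma_sopp i a : iter i g (sopp a) = sopp (iter i g a).
Proof. by rewrite -!iter_gamma_n -!iterD addnC. Qed.

Lemma dist_sopp a b :
  dist a (sopp b) =
    if (dist a b < n)%N then (n + dist a b)%N else (dist a b - n)%N.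
Proof.
have d_lt := dist_lt a b; case: ifP => dn.
  by rewrite -{1}(iter_dist a b) -iter_gamma_n -iterD dist_iter ?ltn_add2l.
rewrite -{1}(iter_dist a b); move/negbT: dn; rewrite -leqNgt => dn.
rewrite -{1}(subnKC dn) iterD iter_gamma_n soppK dist_iter //.
exact: leq_ltn_trans (leq_subr _ _) d_lt.
Qed.

Definition open_arc a b : {set signed n} := [set x | 0 < dist a x < dist a b]%N.

(** Opposite points are [n] steps apart, so an interval with at most [n - 1]
    interior points contains no opposite pair, while the complement of a longer
    one contains none. *)
Lemma one_sided_open_arc a b : one_sided (open_arc a b).
Proof.
have [dn|dn] := leqP (dist a b) n; [left|right] => x; rewrite !inE dist_sopp.
  by case: (ltnP (dist a x) n); lia.
by have := dist_lt a x; case: (ltnP (dist a x) n); lia.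
Qed.

Lemma orbit_gamma a :
  fingraph.orbit g a = [seq iter i g a | i <- iota 0 (n + n)].
Proof.
rewrite /fingraph.orbit order_gamma; apply: (@eq_from_nth _ a).
  by rewrite size_traject size_map size_iota.
move=> i; rewrite size_traject => i_lt.
by rewrite nth_traject // (nth_map 0%N) ?size_iota // nth_iota.
Qed.

Lemma cyclically_orderedP a b c d :
  reflect (exists i j k, [/\ (0 < i < j)%N, (j < k < n + n)%N &
             [/\ b = iter i g a, c = iter j g a & d = iter k g a]])
          (cyclically_ordered a b c d).
Proof.
apply: (iffP hasP) => [[m _]|[i [j [k [ij jk [-> -> ->]]]]]].
  have : fcycle g (rot m (cyc_word n)) by rewrite rot_cycle fcycle_cyc_word.
  have Us : uniq (rot m (cyc_word n)) by rewrite rot_uniq cyc_word_uniq.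
  case rotE : (rot m (cyc_word n)) Us => [//|x s] Us fs.
  have <- : fingraph.orbit g x = x :: s.
    by rewrite (fingraph.orbitE fs Us) ?mem_head //= eqxx rot0.
  rewrite orbit_gamma => /subseqP[t t_size].
  rewrite -map_mask; set r := mask t _.
  have rs : sorted ltn r.
    apply: (subseq_sorted ltn_trans (mask_subseq _ _)).
    exact: iota_ltn_sorted.
  have : {subset r <= iota 0 (n + n)} by move=> i; apply: mem_mask.
  case: r rs => [|i0 [|i1 [|i2 [|i3 [|? ?]]]]] //= /and4P[l1 l2 l3 _] r_lt.
  case=> -> -> -> ->; have := r_lt i3.
  rewrite mem_iota !inE eqxx !orbT => /(_ isT) /= i3_lt.
  exists (i1 - i0)%N, (i2 - i0)%N, (i3 - i0)%N.
  by rewrite -!iterD !subnK; first (split; [lia | lia | by []]); lia.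
have ax : a \in cyc_word n := mem_cyc_word a.
exists (index a (cyc_word n)); first by rewrite mem_iota /= add0n index_mem.
rewrite -(fingraph.orbitE fcycle_cyc_word) ?cyc_word_uniq // orbit_gamma.
have := @map_subseq _ _ (fun l => iter l g a) [:: 0; i; j; k] (iota 0 (n + n)).
apply; apply: subseq_iota => /=; lia.
Qed.

(** Noncrossing symmetric partitions in terms of the relation of being in the
    same block: in this form all conditions are Horn clauses, hence preserved
    by intersections of equivalence relations. *)
Lemma NCP_pblock (P : {set {set signed n}}) :
  P \in NCP n <->
  [/\ finset.partition P [set: signed n],
      forall x y, y \in finset.pblock P x -> sopp y \in finset.pblock P (sopp x)
    & forall a i j k, (0 < i < j)%N -> (j < k < n + n)%N ->
        iter j g a \in finset.pblock P a ->
        iter k g a \in finset.pblock P (iter i g a) ->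
        iter i g a \in finset.pblock P a].
Proof.
rewrite inE; split=> [/and3P[partP /'forall_implyP symP /'forall_implyP ncP]|].
  have /and3P[/eqP coverP tiP _] := partP.
  have inP x : x \in finset.cover P by rewrite coverP inE.
  split=> // [x y xy|a i j k ij jk aj ik].
    have /symP sP := finset.pblock_mem (inP x).
    by rewrite (finset.def_pblock tiP sP) mem_imset ?finset.mem_pblock //;
      apply: inv_inj (@soppK n).
  have /ncP/'forall_implyP := finset.pblock_mem (inP a).
  move=> /(_ _ (finset.pblock_mem (inP (iter i g a)))).
  rewrite implyNb => /orP[/eqP ->|]; first by rewrite finset.mem_pblock.
  case/negP; apply/'exists_andP; exists a.
  rewrite finset.mem_pblock inP; split=> //.
  apply/'exists_andP; exists (iter i g a).
  rewrite finset.mem_pblock inP; split=> //.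
  apply/'exists_andP; exists (iter j g a); split=> //.
  apply/'exists_andP; exists (iter k g a); split=> //.
  by apply/cyclically_orderedP; exists i, j, k.
case=> partP symP ncP; have /and3P[/eqP coverP tiP P0] := partP.
have inP x : x \in finset.cover P by rewrite coverP inE.
rewrite partP /=; apply/andP; split.
  apply/'forall_implyP => B BP; have [B0|[x xB]] := set_0Vmem B.
    by rewrite -B0 BP in P0.
  rewrite -(finset.def_pblock tiP BP xB).
  rewrite (_ : [set _ | _ in _] = finset.pblock P (sopp x)).
    exact: finset.pblock_mem.
  apply/setP=> y; apply/imsetP/idP => [[z zx ->]|yx]; first exact: symP.
  by exists (sopp y); rewrite ?soppK // -[x]soppK symP.
apply/'forall_implyP => B BP; apply/'forall_implyP => B' BP'.
apply/implyP => BB'.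
apply: contra BB' => /'exists_andP[a [aB /'exists_andP[b [bB]]]].
case/'exists_andP=> c [cB].
case/'exists_andP=> d [dB] /cyclically_orderedP[i [j [k [ij jk [bE cE dE]]]]].
move: bB cB dB; rewrite bE cE dE -(finset.def_pblock tiP BP aB) => bB.
rewrite -(finset.def_pblock tiP BP' bB) => cB dB.
by rewrite eq_sym (finset.same_pblock tiP (ncP _ _ _ _ ij jk cB dB)).
Qed.
End CyclicOrder.

(** * A combinatorial description of the elements below gamma *)

Section BelowGamma.
Variables (R : realType) (n : nat).
Implicit Types (a b c d x y : signed n) (u w : {perm signed n}).
Local Notation g := (gamma n).
Local Notation sv := (svec R).

(** A vector fixed by [gamma] is fixed by [gamma ^+ n], which is [-1]. *)
Lemma displ_gamma_unit : displ R g \in unitmx.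
Proof.
rewrite -unitmx_tr -row_free_unit -kermx_eq0; apply/eqP/row_matrixP => i.
rewrite row0; have /sub_kermxP := row_sub i (kermx (displ R g)^T).
move: (row i _) => z zg; rewrite -[z]trmxK.
suff -> : z^T = 0 by rewrite trmx0.
apply: scoord_inj => a; rewrite [RHS]/scoord mulmx0 mxE.
have {}zg : displ R g *m z^T = 0.
  by rewrite -[displ _ _]trmxK -trmx_mul zg trmx0.
have /(displ_ker _ (gamma_Cn n)) inv := zg.
have invk k : scoord z^T (iter k g a) = scoord z^T a.
  by elim: k => //= k IH; rewrite inv.
have := invk n; rewrite iter_gamma_n /scoord svec_sopp linearN /= mulNmx mxE.
by move/eqP; rewrite eq_sym -addr_eq0 -mulr2n mulrn_eq0 /= => /eqP.
Qed.

Lemma below_gamma_displ w :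
  (w \in below_gamma R n) =
  (w \in Cn n) && (displ R w *m invmx (displ R g) *m displ R w == displ R w).
Proof.
rewrite inE; case wC : (w \in Cn n) => //=; have gU := displ_gamma_unit.
rewrite refl_leE ?gamma_Cn // (@minus_order _ _ _ _ _ (invmx (displ R g))).
  by rewrite !submx_full // row_full_unit ?unitmx_tr.
by rewrite mulmxV // mul1mx.
Qed.

(** The sum telescopes; this computes the inverse of [displ R g]. *)
Lemma displ_gamma_vsum a k : (k <= n + n)%N ->
  displ R g *m vsum R [set x | dist a x < k]%N = sv (iter k g a) - sv a.
Proof.
elim: k => [|k IH] kn.
  by rewrite /vsum big_pred0 ?mulmx0 ?subrr // => x; rewrite inE ltn0.
have -> : [set x | dist a x < k.+1]%N = iter k g a |: [set x | dist a x < k]%N.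
  apply/setP=> x; rewrite !inE ltnS leq_eqVlt; congr (_ || _).
  by apply/eqP/eqP => [<-|->]; rewrite ?iter_dist // dist_iter.
rewrite /vsum big_setU1 /=; last by rewrite inE dist_iter // ltnn.
by rewrite mulmxDr IH 1?ltnW // displ_svec ?gamma_Cn // addrA subrK.
Qed.

Lemma vsum_open_arc a b : a != b ->
  vsum R [set x | dist a x < dist a b]%N = sv a + vsum R (open_arc a b).
Proof.
move=> ab; have ab0 : (0 < dist a b)%N by rewrite lt0n dist_eq0.
have -> : [set x | dist a x < dist a b]%N = a |: open_arc a b.
  apply/setP=> x; rewrite !inE (lt0n (dist a x)) dist_eq0 (eq_sym a).
  by have [->|] := eqVneq x a; rewrite ?dist_id ?ab0.
by rewrite /vsum big_setU1 // inE dist_id.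
Qed.

(** On [svec a] the equation of [below_gamma_displ] says that [w] fixes the sum
    of the [svec x] over the open arc from [a] to [w a]; arcs being one-sided,
    this sum determines the arc. *)
Lemma below_gamma_arcs w : w \in below_gamma R n <->
  w \in Cn n /\
  forall a x, (w x \in open_arc a (w a)) = (x \in open_arc a (w a)).
Proof.
rewrite below_gamma_displ; case wC : (w \in Cn n) => /=; last by split=> [|[]].
have key a : (displ R w *m invmx (displ R g) *m displ R w *m sv a =
               displ R w *m sv a) <->
             forall x, (w x \in open_arc a (w a)) = (x \in open_arc a (w a)).
  have [wa|wa] := eqVneq a (w a).
    split=> [_ x|_]; last by rewrite -!mulmxA displ_svec // -wa subrr !mulmx0.
    by rewrite !inE -wa dist_id !ltn0 !andbF.
  rewrite -(@vsum_stable R) //; last exact: one_sided_open_arc.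
  rewrite -[_ *m displ R w]mulmxA -!mulmxA displ_svec //.
  rewrite -{1}(iter_dist a (w a)).
  rewrite -displ_gamma_vsum 1?ltnW ?dist_lt // mulKmx ?displ_gamma_unit //.
  rewrite vsum_open_arc // mulmxDr displ_svec // -[X in _ = X]addr0.
  by split=> [/addrI|->].
split=> [/eqP wE|[_ st]]; first by split=> // a; apply/key; rewrite wE.
by apply/eqP/svec_ext => a; apply/key.
Qed.

End BelowGamma.

(** * Orbits of permutations *)

Section Orbits.
Variable T : finType.
Implicit Types (w : {perm T}) (B : {set T}) (x y z : T).

Lemma partition_porbits w : finset.partition (porbits w) [set: T].
Proof.
have -> : porbits w =
    equivalence_partition (fun x y => y \in porbit w x) [set: T].
  apply/setP=> B; apply/imsetP/imsetP => -[x _ ->]; exists x; rewrite ?inE //;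
  by apply/setP=> y; rewrite !inE.
apply: equivalence_partitionP => x y z _ _ _; split; first exact: porbit_id.
by rewrite -eq_porbit_mem => /eqP ->.
Qed.

Lemma pblock_porbits w x : finset.pblock (porbits w) x = porbit w x.
Proof.
have /and3P[_ tiP _] := partition_porbits w.
by apply: finset.def_pblock; rewrite ?porbit_id // imset_f.
Qed.

Lemma mem_porbit_perm w x y : (w y \in porbit w x) = (y \in porbit w x).
Proof. by rewrite -!eq_porbit_mem -[w y]/((w ^+ 1)%g y) porbit_perm. Qed.

Lemma stable_porbit w B x y :
    (forall z, (w z \in B) = (z \in B)) ->
  y \in porbit w x -> (y \in B) = (x \in B).
Proof.
by move=> wB /porbitP[i ->]; rewrite permX; elim: i => //= i; rewrite wB.
Qed.

Lemma perm_stable w B :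
  (forall x, x \in B -> w x \in B) -> forall x, (w x \in B) = (x \in B).
Proof.
move=> wB x; have wBE : w @: B = B.
  apply/eqP; rewrite eqEcard card_imset ?leqnn ?andbT; last exact: perm_inj.
  by apply/fintype.subsetP=> _ /imsetP[y yB ->]; apply: wB.
by rewrite -{1}wBE mem_imset //; apply: perm_inj.
Qed.
End Orbits.

(** * Elements below gamma have noncrossing orbits *)

Section Noncrossing.
Variables (n : nat).
Implicit Types (a b c d x y : signed n) (u w : {perm signed n}).
Local Notation g := (gamma n).

Lemma porbit_sopp w x y :
  w \in Cn n -> y \in porbit w x -> sopp y \in porbit w (sopp x).
Proof.
move=> wC /porbitP[i ->]; apply/porbitP; exists i; rewrite !permX.
by elim: i => //= i <-; rewrite Cn_sopp.
Qed.

(** Suppose that [a], [b], [c], [d] cross, with [a] and [c] in one orbit and not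
    [b].  Following that orbit from [a], let [e] be the last point before the
    orbit first jumps over [b].  The arc from [e] to [w e] contains [b], hence
    [d], so it also contains [c]; but then it contains the whole orbit of [c],
    including [e]. *)
Lemma porbits_NCP w : w \in Cn n ->
  (forall a x, (w x \in open_arc a (w a)) = (x \in open_arc a (w a))) ->
  porbits w \in NCP n.
Proof.
move=> wC wst; apply/NCP_pblock; split; first exact: partition_porbits.
  by move=> x y; rewrite !pblock_porbits; apply: porbit_sopp.
move=> a i j k /andP[i0 ij] /andP[jk kn]; rewrite !pblock_porbits => ja ki.
apply: contraLR isT => ia.
pose p t := dist a (iter t w a).
have p_neq t : p t != i.
  apply: contra ia => /eqP <-; rewrite iter_dist -permX; exact: mem_porbit.
have [t0 t0_gt] : exists t, (i < p t)%N.
  have /porbitP[t tE] := ja; exists t; rewrite /p -permX -tE dist_iter //.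
  exact: ltn_trans kn.
(* The orbit of a first passes b between its t-th and its (t + 1)-st point. *)
have [[|t] t_gt t_min] := ex_minnP (ex_intro (fun t => i < p t)%N t0 t0_gt).
  by rewrite /p /= dist_id in t_gt.
have tlt : (p t < i)%N.
  by rewrite ltn_neqAle p_neq leqNgt; apply/negP => /t_min; rewrite ltnn.
pose e := iter t w a; have eA : e \in porbit w a.
  by rewrite /e -permX mem_porbit.
have we : p t.+1 = dist a (w e) by [].
have arcE x : (dist a e < dist a x)%N ->
    (x \in open_arc e (w e)) = (dist a x < p t.+1)%N.
  move=> ex; rewrite inE (dist_sub (ltnW ex)).
  rewrite (@dist_sub _ a e (w e)); last first.
    by rewrite -we ltnW // (ltn_trans tlt).
  by rewrite subn_gt0 ex ltn_sub2rE // ltnW.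
have di : dist a (iter i g a) = i by rewrite dist_iter //; lia.
have dj : dist a (iter j g a) = j by rewrite dist_iter //; lia.
have dk : dist a (iter k g a) = k by rewrite dist_iter //; lia.
have /(stable_porbit (wst e)) := ki; rewrite !arcE ?di ?dk //; last first.
  by apply: ltn_trans tlt _; lia.
rewrite t_gt => kp.
have /(stable_porbit (wst e)) := ja; rewrite -(stable_porbit (wst e) eA).
rewrite arcE ?dj; last exact: ltn_trans tlt _.
by rewrite (ltn_trans jk kp) inE dist_id.
Qed.
End Noncrossing.

(** * Refinement and common refinements of partitions *)

Section Refinement.
Variable T : finType.
Implicit Types (P Q : {set {set T}}) (S : {set {set {set T}}}).

Lemma mem_pblock_id P x :
  finset.partition P [set: T] -> x \in finset.pblock P x.
Proof. by case/and3P=> /eqP cP _ _; rewrite finset.mem_pblock cP. Qed.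

Lemma mem_pblockE P x y : finset.partition P [set: T] ->
  (y \in finset.pblock P x) = (finset.pblock P x == finset.pblock P y).
Proof.
by case/and3P=> /eqP cP tP _; rewrite finset.eq_pblock ?cP.
Qed.

Lemma eq_partition P Q :
    finset.partition P [set: T] -> finset.partition Q [set: T] ->
  (forall x, finset.pblock P x = finset.pblock Q x) -> P = Q.
Proof.
move=> partP partQ PQ; rewrite -(equivalence_partition_pblock partP).
rewrite -(equivalence_partition_pblock partQ); congr equivalence_partition.
by apply/funext => x; rewrite PQ.
Qed.

Lemma refinesP P Q :
    finset.partition P [set: T] -> finset.partition Q [set: T] ->
  reflect (forall x y, y \in finset.pblock P x -> y \in finset.pblock Q x)
          (refines P Q).
Proof.
move=> partP partQ; have /and3P[/eqP cP tP P0] := partP.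
have /and3P[/eqP cQ tQ Q0] := partQ.
apply: (iffP 'forall_implyP) => [PQ x y yx|PQ B BP].
  have /PQ/'exists_andP[B [BQ sB]] : finset.pblock P x \in P.
    by rewrite finset.pblock_mem ?cP.
  have xB := fintype.subsetP sB _ (mem_pblock_id x partP).
  by rewrite (finset.def_pblock tQ BQ xB) (fintype.subsetP sB).
have [B0|[x xB]] := set_0Vmem B; first by rewrite -B0 BP in P0.
apply/'exists_andP; exists (finset.pblock Q x).
rewrite finset.pblock_mem ?cQ //; split=> //.
by apply/fintype.subsetP=> y; rewrite -(finset.def_pblock tP BP xB); apply: PQ.
Qed.

Definition common_refinement S : {set {set T}} :=
  equivalence_partition (fun x y => [forall P in S, y \in finset.pblock P x])
                        [set: T].

Section CommonRefinement.
Variable S : {set {set {set T}}}.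
Hypothesis partS : {in S, forall P, finset.partition P [set: T]}.

Let rel_equiv : {in [set: T] & &,
  equivalence_rel (fun x y => [forall P in S, y \in finset.pblock P x])}.
Proof.
move=> x y z _ _ _; split.
  by apply/'forall_implyP => P PS; apply: mem_pblock_id (partS PS).
move=> /'forall_implyP xy; apply: eq_forallb => P; apply: implyb_id2l => PS.
by move: (xy P PS); rewrite !mem_pblockE ?partS // => /eqP ->.
Qed.

Lemma partition_common_refinement :
  finset.partition (common_refinement S) [set: T].
Proof. exact: equivalence_partitionP. Qed.

Lemma pblock_common_refinement x y :
  (y \in finset.pblock (common_refinement S) x) =
  [forall P in S, y \in finset.pblock P x].
Proof. by rewrite pblock_equivalence_partition ?inE. Qed.

Lemma refines_common_refinement Q : finset.partition Q [set: T] ->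
  refines Q (common_refinement S) = [forall P in S, refines Q P].
Proof.
move=> partQ; apply/(refinesP partQ partition_common_refinement)/'forall_implyP.
  move=> QS P PS; apply/refinesP=> // [|x y /QS]; first exact: partS.
  by rewrite pblock_common_refinement => /'forall_implyP; apply.
move=> QS x y yx; rewrite pblock_common_refinement.
apply/'forall_implyP => P PS.
by have /refinesP := QS P PS; apply=> //; apply: partS.
Qed.
End CommonRefinement.
End Refinement.

(** * Noncrossing partitions as orbit partitions *)

Section NoncrossingPartitions.
Variables (n : nat).
Implicit Types (a b c d x y : signed n) (u w : {perm signed n}).
Implicit Types (P : {set {set signed n}}).
Local Notation g := (gamma n).

Lemma NCP_common_refinement (S : {set {set {set signed n}}}) :
  S \subset NCP n -> common_refinement S \in NCP n.
Proof.
move=> /fintype.subsetP SN.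
have partS : {in S, forall P, finset.partition P [set: signed n]}.
  by move=> P /SN/NCP_pblock[].
apply/NCP_pblock; split; first exact: partition_common_refinement.
  move=> x y; rewrite !pblock_common_refinement // => /'forall_implyP xy.
  apply/'forall_implyP => P PS; have /SN/NCP_pblock[_ symP _] := PS.
  exact/symP/xy.
move=> a i j k ij jk; rewrite !pblock_common_refinement //.
move=> /'forall_implyP aj /'forall_implyP ik; apply/'forall_implyP => P PS.
have /SN/NCP_pblock[_ _ ncP] := PS.
exact: ncP ij jk (aj P PS) (ik P PS).
Qed.

(** Two distinct self-opposite blocks would cross: [a], [b], [-a], [-b] occur in
    this cyclic order, after exchanging [b] and [-b] if necessary. *)
Lemma NCP_self_opposite P a b : P \in NCP n ->
  sopp a \in finset.pblock P a -> sopp b \in finset.pblock P b ->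
  b \in finset.pblock P a.
Proof.
move=> /NCP_pblock[partP symP ncP] aa bb; have i_lt := dist_lt a b.
have bE := iter_dist a b; case: (posnP (dist a b)) => [i0|i0].
  by rewrite -bE i0 /= mem_pblock_id.
have [i_n|i_n|i_n] := ltngtP (dist a b) n.
- rewrite -bE; apply: (ncP a _ n (n + dist a b)%N); rewrite ?iter_gamma_n //;
    try lia.
  by rewrite iterD bE iter_gamma_n.
- have b'E : iter (dist a b - n) g a = sopp b.
    rewrite -[RHS]iter_gamma_n -{2}bE -{2}(subnKC (ltnW i_n)) -iterD addnA.
    by rewrite iterD iter_gamma2n.
  have bbE : finset.pblock P b = finset.pblock P (sopp b).
    by apply/eqP; rewrite -mem_pblockE.
  rewrite mem_pblockE // bbE -mem_pblockE // -b'E.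
  apply: (ncP a _ n (dist a b)); rewrite ?iter_gamma_n //; try lia.
  by rewrite b'E bE mem_pblockE // bbE.
- by move: bE; rewrite i_n iter_gamma_n => <-.
Qed.

(** The permutation sends each point to the next point of its block.  A point
    strictly between [a] and its successor belongs to another block, which
    cannot leave the arc without crossing the block of [a]. *)
Lemma NCP_perm P : P \in NCP n ->
  exists2 w, w \in Cn n & porbits w = P /\
    forall a x, (w x \in open_arc a (w a)) = (x \in open_arc a (w a)).
Proof.
move=> /NCP_pblock[partP symP ncP].
pose blk := finset.pblock P; have blkE x y : (y \in blk x) = (blk x == blk y).
  exact: mem_pblockE.
have step a : exists k, [/\ (0 < k <= n + n)%N, iter k g a \in blk a &
    forall j, (0 < j < k)%N -> iter j g a \notin blk a].
  have exk : exists k, (0 < k)%N && (iter k g a \in blk a).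
    exists (n + n)%N; rewrite iter_gamma2n blkE eqxx andbT.
    by case: a => _ [i]; lia.
  case: (ex_minnP exk) => k /andP[k0 kP] k_min; exists k; split=> //.
    rewrite k0 k_min // iter_gamma2n blkE eqxx andbT.
    by case: (a) => _ [i]; lia.
  move=> j /andP[j0 jk]; apply: contraTN jk => jP.
  by rewrite -leqNgt k_min // j0.
(* f a is the number of steps from a to its successor; it is n + n, rather than
   0, when the block of a is a singleton. *)
have [f fP] := fin_all_exists step.
pose s a := iter (f a) g a.
have s_blk a : blk (s a) = blk a.
  by have [_ sa _] := fP a; rewrite blkE in sa; apply/esym/eqP.
have f_min a k : (0 < k)%N -> iter k g a \in blk a -> (f a <= k)%N.
  move=> k0; have [_ _ fm] := fP a; apply: contraLR.
  by rewrite -ltnNge => kf; rewrite fm ?k0.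
have s_inj : injective s.
  move=> a b; wlog fab : a b / (f a <= f b)%N => [hw|].
    by case/orP: (leq_total (f a) (f b)) => [/hw//|/hw h /esym/h ->].
  move=> sab; have : iter (f a) g a = iter (f a) g (iter (f b - f a) g b).
    by rewrite -iterD subnKC.
  rewrite -!permX => /perm_inj; rewrite permX => aE.
  have [d0|d0] := posnP (f b - f a); first by rewrite aE d0.
  have := f_min b _ d0; rewrite -aE blkE -(s_blk a) sab s_blk eqxx => /(_ isT).
  by have [/andP[f0 _] _ _] := fP a; lia.
pose w := perm s_inj; have wE x : w x = s x by rewrite permE.
have f_sopp a : f (sopp a) = f a.
  suff le b : (f (sopp b) <= f b)%N.
    by apply/eqP; rewrite eqn_leq le -{1}[a]soppK le.
  have [/andP[f0 _] fb _] := fP b.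
  by apply: f_min => //; rewrite iter_gamma_sopp symP.
have wC : w \in Cn n.
  by rewrite inE; apply/forallP=> a; rewrite !wE /s f_sopp iter_gamma_sopp.
have blk_orb m a : iter m g a \in blk a -> iter m g a \in porbit w a.
  have [N] := ubnP m; elim: N m a => // N IH [|m] a mN ma.
    exact: porbit_id.
  have fm : (f a <= m.+1)%N by apply: f_min.
  have [/andP[f0 _] _ _] := fP a.
  have mE : iter m.+1 g a = iter (m.+1 - f a) g (s a) by rewrite -iterD subnK.
  have -> : porbit w a = porbit w (s a).
    by rewrite -wE -{1}(porbit_perm w 1 a) expg1.
  by rewrite mE; apply: IH; [lia | rewrite blkE s_blk -mE -blkE].
exists w => //; split.
  apply: eq_partition partP _ => [|x]; first exact: partition_porbits.
  apply/setP=> y; rewrite pblock_porbits; apply/idP/idP => [yx|yx].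
    have wst z : (w z \in blk x) = (z \in blk x) by rewrite !blkE wE s_blk.
    by rewrite (stable_porbit wst yx) blkE.
  by rewrite -(iter_dist x y) blk_orb // iter_dist.
move=> a; apply: perm_stable => x; rewrite !inE wE => /andP[x0 xf].
have [/andP[f0 f2n] fa fm] := fP a.
have f_lt : (f a < n + n)%N.
  rewrite ltn_neqAle f2n andbT; apply: contraTneq xf => fE.
  by rewrite /s fE iter_gamma2n dist_id.
have sE : dist a (s a) = f a by rewrite dist_iter.
rewrite sE in xf *; have xa : x \notin blk a.
  by rewrite -(iter_dist a x) fm // x0.
have wxa : blk (w x) != blk a by rewrite wE s_blk eq_sym -blkE.
apply/andP; split.
  by rewrite lt0n dist_eq0; apply: contra wxa => /eqP ->; rewrite wE.
rewrite ltnNge leq_eqVlt wE; apply/negP => /orP[/eqP e|lt].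
  case/eqP: wxa; rewrite wE -(s_blk a); congr blk.
  by rewrite -(iter_dist a (s x)) -e.
case/negP: xa; rewrite -(iter_dist a x).
apply: (ncP a _ (f a) (dist a (s x))); rewrite ?x0 ?xf ?lt ?dist_lt //.
by rewrite !iter_dist -/(blk _) blkE s_blk.
Qed.
End NoncrossingPartitions.

(** * The order below gamma is refinement of orbits *)

Section OrderIsomorphism.
Variables (R : realType) (n : nat).
Implicit Types (a b x y : signed n) (u w : {perm signed n}).

Lemma submx_kernel (A B : 'M[R]_n) :
  (A <= B)%MS <-> forall z : 'cV_n, B *m z = 0 -> A *m z = 0.
Proof.
split=> [/submxP[X ->] z Bz|AB]; first by rewrite -mulmxA Bz mulmx0.
rewrite submxE; apply/eqP/svec_ext => a; rewrite mul0mx -mulmxA AB //.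
by rewrite mulmxA mulmx_coker mul0mx.
Qed.

Lemma below_gamma_NCP w : w \in below_gamma R n -> porbits w \in NCP n.
Proof. by case/below_gamma_arcs; apply: porbits_NCP. Qed.

(** Both elements satisfy the quadratic condition of [minus_order] with the same
    matrix [H], the inverse of [displ R (gamma n)], so only the inclusion of row
    spaces remains. *)
Lemma refl_le_submx u w : u \in below_gamma R n -> w \in below_gamma R n ->
  refl_le R u w = (displ R u <= displ R w)%MS.
Proof.
rewrite !below_gamma_displ => /andP[uC uu] /andP[wC /eqP ww].
rewrite refl_leE // (minus_order _ ww) uu andbT.
by rewrite !displ_tr_eqmx // andbb.
Qed.

(** Row space inclusion means that [u] fixes every vector fixed by [w], in
    particular the vector of a [w]-stable one-sided set. *)
Lemma submx_displ_stable u w (B : {set signed n}) :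
    u \in Cn n -> w \in Cn n -> (displ R u <= displ R w)%MS -> one_sided B ->
  (forall x, (w x \in B) = (x \in B)) -> forall x, (u x \in B) = (x \in B).
Proof.
move=> uC wC /submx_kernel uw Bs wB.
by apply/(@vsum_stable R) => //; apply/uw/vsum_stable.
Qed.

(** If [u <= w], then [u] preserves each orbit of [w] that is not self-opposite,
    since such an orbit is one-sided.  A self-opposite orbit is not seen by the
    fixed vectors, but it is unique: if [u] took a point of it out of it, that
    point would land in a one-sided orbit, which [u] preserves.  Conversely,
    under refinement the coordinates of a vector fixed by [w] are constant on
    the orbits of [u], so [u] fixes it. *)
Lemma refl_le_refines u w : u \in below_gamma R n -> w \in below_gamma R n ->
  refl_le R u w = refines (porbits u) (porbits w).
Proof.
move=> uD wD; rewrite refl_le_submx //.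
have [[uC _] [wC _]] :=
  (iffLR (below_gamma_arcs _ _) uD, iffLR (below_gamma_arcs _ _) wD).
have wN := below_gamma_NCP wD.
apply/idP/(refinesP (partition_porbits _) (partition_porbits _)) => [uw|uw].
  suff stable x z : z \in porbit w x -> u z \in porbit w x.
    move=> x y; rewrite !pblock_porbits => yx.
    by rewrite (stable_porbit (perm_stable (stable x)) yx) porbit_id.
  have st := submx_displ_stable uC wC uw.
  move=> zx; apply: contraT => uzx.
  have not_one_sided c : ~ one_sided (porbit w c) -> sopp c \in porbit w c.
    move=> nos; apply: contraT => cN; case: nos; left=> y yc.
    apply: contra cN; rewrite -eq_porbit_mem => /eqP <-.
    by apply: porbit_sopp wC _; rewrite porbit_sym.
  have [Bs|Bn] := pselect (one_sided (porbit w x)).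
    by rewrite (st _ Bs (mem_porbit_perm w x)) zx in uzx.
  have [Cs|Cn'] := pselect (one_sided (porbit w (u z))).
    have := st _ Cs (mem_porbit_perm w _) z; rewrite porbit_id => /esym.
    rewrite porbit_sym -eq_porbit_mem => /eqP e.
    by rewrite -eq_porbit_mem e eq_porbit_mem zx in uzx.
  have := @NCP_self_opposite _ _ x (u z) wN; rewrite !pblock_porbits.
  by rewrite !not_one_sided // (negPf uzx) => /(_ isT isT).
apply/submx_kernel => z /(displ_ker _ wC) wz; apply/displ_ker => // a.
have /porbitP[i ->] : u a \in porbit w a.
  have := uw a (u a).
  by rewrite !pblock_porbits mem_porbit_perm porbit_id; apply.
by rewrite permX; elim: i => //= i <-.
Qed.

Lemma porbits_inj : {in below_gamma R n &, injective (@porbits (signed n))}.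
Proof.
move=> u w uD wD uw; have [uC wC] : u \in Cn n /\ w \in Cn n.
  by split; [case/below_gamma_arcs: uD | case/below_gamma_arcs: wD].
have ref (v : {perm signed n}) : refines (porbits v) (porbits v).
  by apply/(refinesP (partition_porbits v) (partition_porbits v)).
have : refl_le R u w by rewrite refl_le_refines // uw.
have : refl_le R w u by rewrite refl_le_refines // uw.
rewrite !refl_leE // => /eqP ->.
rewrite -addnA -[X in X == _]addn0 eqn_add2l eq_sym addn_eq0 => /andP[_ wu0].
apply: (@displ_inj R n) => //; apply/eqP.
by rewrite eq_sym -subr_eq0 -mxrank_eq0.
Qed.

Lemma porbits_surj P :
  P \in NCP n -> exists2 w, w \in below_gamma R n & porbits w = P.
Proof.
move=> PN; have [w wC [wP wst]] := NCP_perm PN; exists w => //.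
exact/below_gamma_arcs.
Qed.

(** Transported from the common refinement of the orbit partitions. *)
Lemma below_gamma_glb (S : {set {perm signed n}}) : S \subset below_gamma R n ->
  exists2 z, z \in below_gamma R n &
    {in below_gamma R n, forall t,
      refl_le R t z = [forall s in S, refl_le R t s]}.
Proof.
move=> /fintype.subsetP SD; pose PS := [set porbits s | s in S].
have PS_N : PS \subset NCP n.
  by apply/fintype.subsetP=> _ /imsetP[s sS ->]; rewrite below_gamma_NCP ?SD.
have [z zD zP] := porbits_surj (NCP_common_refinement PS_N).
exists z => // t tD; rewrite refl_le_refines // zP.
rewrite refines_common_refinement ?partition_porbits //; last first.
  by move=> _ /imsetP[s _ ->]; apply: partition_porbits.
apply/'forall_implyP/'forall_implyP => h => [s sS|_ /imsetP[s sS ->]].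
  by rewrite refl_le_refines ?(SD s) // h ?imset_f.
by rewrite -refl_le_refines ?(SD s) // h.
Qed.

Lemma below_gamma_lattice : lattice_on (below_gamma R n) (@refl_le R n).
Proof.
set D := below_gamma R n.
have refl : {in D, reflexive (@refl_le R n)}.
  by move=> u uD; rewrite refl_le_submx.
have trans : {in D & &, transitive (@refl_le R n)}.
  move=> v u w vD uD wD; rewrite !refl_le_submx //; exact: submx_trans.
split=> // [u w uD wD|u w uD wD|u w uD wD].
- rewrite !refl_le_refines // => /andP[uw wu]; apply: porbits_inj => //.
  have partu := partition_porbits u; have partw := partition_porbits w.
  apply: eq_partition => // x; apply/setP=> y; apply/idP/idP.
    exact: (refinesP partu partw uw).
  exact: (refinesP partw partu wu).
- have [|z zD zP] := @below_gamma_glb [set u; w].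
    by apply/fintype.subsetP=> s /set2P[] ->.
  exists z => // t tD; rewrite zP //.
  apply/'forall_implyP/andP => [h|[tu tw] s].
    by rewrite !h ?set21 ?set22.
  by case/set2P=> ->.
(* The join is the meet of all upper bounds. *)
have [|z zD zP] :=
    @below_gamma_glb [set s in D | refl_le R u s && refl_le R w s].
  by apply/fintype.subsetP=> s; rewrite inE => /andP[].
exists z => // t tD; apply/idP/andP => [zt|[ut wt]].
  split; apply: (trans z) => //; rewrite zP //; apply/'forall_implyP => s.
    by rewrite inE => /and3P[].
  by rewrite inE => /and3P[].
have := refl z zD; rewrite zP // => /'forall_implyP; apply.
by rewrite inE tD ut.
Qed.
End OrderIsomorphism.

Theorem theorem4p9 (R : realType) (n : nat) (hn : (1 <= n)%N) :
  [/\ set_bij [set` below_gamma R n]%classic [set` NCP n]%classic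
        (fun w : {perm signed n} => porbits w),
      {in below_gamma R n &, forall u w : {perm signed n},
         refl_le R u w -> refines (porbits u) (porbits w)}
    & lattice_on (below_gamma R n) (@refl_le R n)].
Proof.
split; last exact: below_gamma_lattice.
  split=> [w|u w|P PN]; first exact: below_gamma_NCP.
    by rewrite !inE /=; apply: porbits_inj.
  by have [w wD wP] := porbits_surj R PN; exists w.
by move=> u w uD wD; rewrite refl_le_refines.
Qed.
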